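(* Let $k$ be a field. For every integer $n \in \mathbb{Z}$, $\nu_n$ is a gauge invariant of finite-dimensional Hopf algebras over $k$; that is, if $H$ and $H'$ are finite-dimensional Hopf algebras over $k$ that are gauge equivalent, then $\nu_n(H) = \nu_n(H')$.
   Context: For a finite-dimensional Hopf algebra $H$ with antipode $S$ and any $n \in \mathbb{Z}$, $\nu_n(H) = \mathrm{Tr}(S \circ P_H^{(n-1)}: H \to H) \in k$, where $P_H^{(m)}$ ($m \in \mathbb{Z}$) is the $m$-th power of $\mathrm{id}_H$ in the convolution algebra $\mathrm{End}_k(H)$: for $m \ge 1$, $P_H^{(m)}(h) = h_{(1)}\cdots h_{(m)}$, $P_H^{(0)}(h) = \varepsilon(h)1$, $P_H^{(-m)}(h) = S(h_{(1)})\cdots S(h_{(m)})$. A twist of $H$ is an invertible $F \in H \otimes H$ with $(\varepsilon \otimes \mathrm{id})(F) = 1 = (\mathrm{id} \otimes \varepsilon)(F)$ and $(F \otimes 1)(\Delta \otimes \mathrm{id})(F) = (1 \otimes F)(\mathrm{id} \otimes \Delta)(F)$. Then $H_F$, the algebra $H$ with the same counit and comultiplication $\Delta_F(h) = F\Delta(h)F^{-1}$, is a Hopf algebra. $H$ and $H'$ are gauge equivalent if $H' \cong H_F$ as Hopf algebras for some twist $F$ of $H$. (For finite-dimensional Hopf algebras this is equivalent, by a theorem of Schauenburg, to the categories of left modules being equivalent as $k$-linear monoidal categories.) The case $n \ge 1$ is a known result of Kashina, Montgomery and Ng. *)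

(* Defs.v *)
From HB Require Import structures.
From mathcomp Require Import all_boot all_algebra falgebra.

Set Warnings "-redundant-canonical-projection".

Set Implicit Arguments.
Unset Strict Implicit.
Unset Printing Implicit Defensive.

Import GRing.Theory.
Local Open Scope ring_scope.

Reserved Notation "x \ox y" (at level 35, right associativity).

(* An element of [tensor V W] is the matrix of its coefficients on the        *)
(* products of the vectors of [vbasis {:V}] and [vbasis {:W}].                *)
Definition tensor (k : fieldType) (V W : vectType k) : Type :=
  'M[k]_(\dim {:V}, \dim {:W}).

Section TensorSpace.
Context {k : fieldType}.
Implicit Types U V W : vectType k.

HB.instance Definition _ V W :=
  Vector.copy (tensor V W) 'M[k]_(\dim {:V}, \dim {:W}).

Definition tens V W (v : V) (w : W) : tensor V W :=
  \matrix_(i, j) (coord (vbasis {:V}) i v * coord (vbasis {:W}) j w).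

Local Notation "x \ox y" := (tens x y).

(* The linear map on [tensor V W] induced by a bilinear map [f] (see          *)
(* [tlift_tens]): in Sweedler notation, [tlift f t] is f(t', t'').            *)
Definition tlift V W U (f : V -> W -> U) (t : tensor V W) : U :=
  \sum_i \sum_j t i j *: f (vbasis {:V})`_i (vbasis {:W})`_j.

Definition bilin V W U (f : V -> W -> U) : Prop :=
  (forall w, linear (f^~ w)) /\ (forall v, linear (f v)).

Fact tlift_is_linear V W U (f : V -> W -> U) : linear (tlift f).
Proof.
move=> a s t; rewrite /tlift scaler_sumr -big_split; apply: eq_bigr => i _ /=.
rewrite scaler_sumr -big_split; apply: eq_bigr => j _ /=.
by rewrite !mxE scalerDl scalerA.
Qed.
HB.instance Definition _ V W U (f : V -> W -> U) :=
  GRing.isLinear.Build k (tensor V W) U _ (tlift f) (tlift_is_linear f).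

Lemma tens_linearl V W (w : W) : linear (fun v : V => v \ox w).
Proof.
by move=> a v v'; apply/matrixP=> i j; rewrite !mxE linearP /= mulrDl mulrA.
Qed.

Lemma tens_linearr V W (v : V) : linear (fun w : W => v \ox w).
Proof.
move=> a w w'; apply/matrixP=> i j; rewrite !mxE linearP /= mulrDr.
by rewrite mulrCA.
Qed.

Lemma tens_bilin V W : bilin (@tens V W).
Proof. by split; [apply: tens_linearl | apply: tens_linearr]. Qed.

Lemma tensE V W (t : tensor V W) :
  t = \sum_i \sum_j t i j *: ((vbasis {:V})`_i \ox (vbasis {:W})`_j).
Proof.
apply/matrixP=> i j; rewrite summxE (bigD1 i) //= summxE (bigD1 j) //=.
have fV := basis_free (vbasisP {:V}); have fW := basis_free (vbasisP {:W}).
rewrite !mxE !coord_free // !eqxx !mulr1 !big1 ?addr0 //.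
  move=> i' ni; rewrite summxE big1 // => j' _.
  have {ni}ni : (i' == i) = false by apply: negbTE.
  by rewrite !mxE !coord_free // ni mul0r mulr0.
move=> j' nj; have {nj}nj : (j' == j) = false by apply: negbTE.
by rewrite !mxE !coord_free // nj !mulr0.
Qed.

Lemma tens_ind V W (P : tensor V W -> Prop) :
    (forall a s t, P s -> P t -> P (a *: s + t)) ->
    (forall v w, P (v \ox w)) ->
  forall t, P t.
Proof.
move=> Plin Ptens t; have P0 : P 0.
  have <- : (-1) *: (0 \ox 0) + (0 \ox 0) = 0 :> tensor V W.
    by rewrite scaleN1r addNr.
  exact: Plin.
have PD s s' : P s -> P s' -> P (s + s').
  by move=> Ps Ps'; rewrite -[s]scale1r; apply: Plin.
rewrite (tensE t); apply: big_ind => // i _; apply: big_ind => // j _.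
by rewrite -[X in P X]addr0; apply: Plin.
Qed.

Lemma eq_tens_linear V W U (f g : {linear tensor V W -> U}) :
  (forall v w, f (v \ox w) = g (v \ox w)) -> f =1 g.
Proof.
by move=> efg; apply: tens_ind => // a s t es et; rewrite !linearP es et.
Qed.

Lemma tlift_tens V W U (f : V -> W -> U) v w :
  bilin f -> tlift f (v \ox w) = f v w.
Proof.
case=> fl fr.
pose Fl w0 : {linear V -> U} :=
  HB.pack (f^~ w0) (GRing.isLinear.Build _ _ _ _ _ (fl w0)).
pose Fr v0 : {linear W -> U} :=
  HB.pack (f v0) (GRing.isLinear.Build _ _ _ _ _ (fr v0)).
rewrite {2}(coord_vbasis (memvf v)) -[f _ _]/(Fl w _) linear_sum.
apply: eq_bigr => i _; rewrite linearZ /= -[f _ _]/(Fr _ _).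
rewrite {2}(coord_vbasis (memvf w)) linear_sum scaler_sumr.
by apply: eq_bigr => j _; rewrite linearZ /= scalerA mxE.
Qed.

Lemma eq_tlift V W U (f g : V -> W -> U) t :
  (forall v w, f v w = g v w) -> tlift f t = tlift g t.
Proof.
by move=> efg; apply: eq_bigr => i _; apply: eq_bigr => j _; rewrite efg.
Qed.

Lemma linear_tlift V W U U' (L : {linear U -> U'}) (f : V -> W -> U) t :
  L (tlift f t) = tlift (fun v w => L (f v w)) t.
Proof.
rewrite linear_sum; apply: eq_bigr => i _.
by rewrite linear_sum; apply: eq_bigr => j _; rewrite linearZ.
Qed.

Lemma tliftP V W U (f g : V -> W -> U) a t :
  tlift (fun v w => a *: f v w + g v w) t = a *: tlift f t + tlift g t.
Proof.
rewrite /tlift scaler_sumr -big_split; apply: eq_bigr => i _ /=.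
rewrite scaler_sumr -big_split; apply: eq_bigr => j _ /=.
by rewrite scalerDr !scalerA mulrC.
Qed.

Lemma tliftZ V W U a (f : V -> W -> U) t :
  tlift (fun v w => a *: f v w) t = a *: tlift f t.
Proof.
rewrite -[RHS]addr0 -[X in _ + X](_ : tlift (fun _ _ => 0) t = 0).
  by rewrite -tliftP; apply: eq_tlift => v w; rewrite addr0.
by apply: big1 => i _; apply: big1 => j _; rewrite scaler0.
Qed.

Lemma tlift_sum V W U I (r : seq I) (F : I -> V -> W -> U) t :
  tlift (fun v w => \sum_(i <- r) F i v w) t = \sum_(i <- r) tlift (F i) t.
Proof.
elim: r => [|i r IH].
  rewrite big_nil; apply: big1 => i _; apply: big1 => j _.
  by rewrite big_nil scaler0.
rewrite big_cons -IH -[tlift (F i) t]scale1r -tliftP.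
by apply: eq_tlift => v w; rewrite big_cons scale1r.
Qed.

Lemma exchange_tlift V W V' W' U (f : V -> W -> V' -> W' -> U) s t :
  tlift (fun a b => tlift (f a b) t) s =
  tlift (fun c d => tlift (fun a b => f a b c d) s) t.
Proof.
pose G (i : 'I_(\dim {:V})) (j : 'I_(\dim {:W})) c d :=
  f (vbasis {:V})`_i (vbasis {:W})`_j c d.
transitivity (tlift (fun c d => \sum_i \sum_j s i j *: G i j c d) t) => //.
rewrite tlift_sum; apply: eq_bigr => i _.
by rewrite tlift_sum; apply: eq_bigr => j _; rewrite tliftZ.
Qed.

Definition tmap V W V' W' (f : V -> V') (g : W -> W') :
  tensor V W -> tensor V' W' := tlift (fun v w => f v \ox g w).
HB.instance Definition _ V W V' W' (f : V -> V') (g : W -> W') :=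
  GRing.Linear.copy (tmap f g) (tlift (fun v w => f v \ox g w)).

Definition tassoc U V W :
    tensor (tensor U V) W -> tensor U (tensor V W) :=
  tlift (fun t w => tlift (fun u v => u \ox (v \ox w)) t).
HB.instance Definition _ U V W := GRing.Linear.copy (@tassoc U V W)
  (tlift (fun t w => tlift (fun u v => u \ox (v \ox w)) t)).

End TensorSpace.

Notation "x \ox y" := (tens x y) : ring_scope.

Section TensorAlgebra.
Context {k : fieldType}.

Lemma bilin_tlift (V W V' W' U : vectType k) (f : V -> W -> V' -> W' -> U) t :
  (forall c d, bilin (fun a b => f a b c d)) ->
  bilin (fun a b => tlift (f a b) t).
Proof.
move=> fP; split=> [b x a a'|a x b b'] /=; rewrite -tliftP;
  apply: eq_tlift => c d.
  exact: (fP c d).1.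
exact: (fP c d).2.
Qed.

Lemma tensPl (V W : vectType k) x (v v' : V) (w : W) :
  (x *: v + v') \ox w = x *: (v \ox w) + v' \ox w.
Proof. exact: tens_linearl. Qed.

Lemma tensPr (V W : vectType k) x (v : V) (w w' : W) :
  v \ox (x *: w + w') = x *: (v \ox w) + v \ox w'.
Proof. exact: tens_linearr. Qed.

Lemma mulPl (A : falgType k) x (a a' b : A) :
  (x *: a + a') * b = x *: (a * b) + a' * b.
Proof. by rewrite mulrDl scalerAl. Qed.

Lemma mulPr (A : falgType k) x (a b b' : A) :
  a * (x *: b + b') = x *: (a * b) + a * b'.
Proof. by rewrite mulrDr scalerAr. Qed.

Lemma scalePl (V : vectType k) x (a a' : k^o) (v : V) :
  ((x *: a + a' : k^o) : k) *: v = x *: ((a : k) *: v) + (a' : k) *: v.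
Proof. by rewrite scalerDl scalerA. Qed.

Lemma scalePr (V : vectType k) x a (v v' : V) :
  a *: (x *: v + v') = x *: (a *: v) + a *: v'.
Proof. by rewrite scalerDr !scalerA mulrC. Qed.

Definition multilinE := (mulPl, mulPr, tensPl, tensPr, scalePl, scalePr).

End TensorAlgebra.

Ltac multilin :=
  split=> ? ? ? ? /=; do ?[rewrite linearP /=]; rewrite ?multilinE //;
  do ?[rewrite linearP /=]; rewrite ?multilinE.

Section TensorFalgebra.
Context {k : fieldType} (A B : falgType k).
Implicit Types s t u : tensor A B.

Definition tens1 : tensor A B := 1 \ox 1.
Definition tens_mul s t : tensor A B :=
  tlift (fun a b => tlift (fun c d => (a * c) \ox (b * d)) t) s.

Lemma tens_mulPr s a t u :
  tens_mul s (a *: t + u) = a *: tens_mul s t + tens_mul s u.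
Proof.
by rewrite /tens_mul -tliftP; apply: eq_tlift => x y; rewrite linearP.
Qed.

Lemma tens_mulPl s a t u :
  tens_mul (a *: t + u) s = a *: tens_mul t s + tens_mul u s.
Proof. by rewrite /tens_mul linearP. Qed.

Lemma tens_mulE a b c d : tens_mul (a \ox b) (c \ox d) = (a * c) \ox (b * d).
Proof.
rewrite /tens_mul tlift_tens; last by apply: bilin_tlift => ? ?; multilin.
by rewrite tlift_tens //; multilin.
Qed.

Fact tens_mulA : associative tens_mul.
Proof.
move=> s t u; elim/(@tens_ind k A B): s => [x s s' es es'|a b].
  by rewrite !tens_mulPl es es'.
elim/(@tens_ind k A B): t => [x s s' es es'|c d].
  by rewrite !(tens_mulPl, tens_mulPr) es es'.
elim/(@tens_ind k A B): u => [x s s' es es'|e f].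
  by rewrite !(tens_mulPl, tens_mulPr) es es'.
by rewrite !tens_mulE !mulrA.
Qed.

Fact tens_mul1r : left_id tens1 tens_mul.
Proof.
elim/(@tens_ind k A B)=> [x s s' es es'|a b].
  by rewrite tens_mulPr es es'.
by rewrite tens_mulE !mul1r.
Qed.

Fact tens_mulr1 : right_id tens1 tens_mul.
Proof.
elim/(@tens_ind k A B)=> [x s s' es es'|a b].
  by rewrite tens_mulPl es es'.
by rewrite tens_mulE !mulr1.
Qed.

Fact tens_mulDl : left_distributive tens_mul +%R.
Proof. by move=> s t u; rewrite -[s]scale1r tens_mulPl !scale1r. Qed.

Fact tens_mulDr : right_distributive tens_mul +%R.
Proof. by move=> s t u; rewrite -[t]scale1r tens_mulPr !scale1r. Qed.

Fact coord_neq0 (V : vectType k) (v : V) :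
  v != 0 -> exists i, coord (vbasis {:V}) i v != 0.
Proof.
move=> v0; apply/existsP; rewrite -[X in is_true X]negbK; apply: contraNN v0.
move=> /existsPn vi; rewrite (coord_vbasis (memvf v)) big1 // => i _.
by move/eqP: (negPn (vi i)) => ->; rewrite scale0r.
Qed.

Fact tens1_neq0 : tens1 != 0.
Proof.
have [i ai] := coord_neq0 (oner_neq0 A).
have [j bj] := coord_neq0 (oner_neq0 B).
apply/eqP => /matrixP/(_ i j)/eqP; rewrite !mxE mulf_eq0.
by rewrite (negPf ai) (negPf bj).
Qed.

HB.instance Definition _ := GRing.Zmodule_isNzRing.Build (tensor A B)
  tens_mulA tens_mul1r tens_mulr1 tens_mulDl tens_mulDr tens1_neq0.

Fact tens_scalerAl x s t : x *: (s * t) = x *: s * t.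
Proof. by rewrite -[RHS]/(tens_mul _ _) /tens_mul linearZ. Qed.

HB.instance Definition _ :=
  GRing.Lmodule_isLalgebra.Build k (tensor A B) tens_scalerAl.

Fact tens_scalerAr x s t : x *: (s * t) = s * (x *: t).
Proof.
have t0 : tens_mul s 0 = 0.
  by apply: big1 => i _; apply: big1 => j _; rewrite linear0 scaler0.
by rewrite -[x *: t]addr0 -[RHS]/(tens_mul _ _) tens_mulPr t0 addr0.
Qed.

HB.instance Definition _ :=
  GRing.Lalgebra_isAlgebra.Build k (tensor A B) tens_scalerAr.
HB.instance Definition _ := Algebra_isFalgebra.Build k (tensor A B).

Lemma tensM (a c : A) (b d : B) : (a \ox b) * (c \ox d) = (a * c) \ox (b * d).
Proof. exact: tens_mulE. Qed.

Lemma tens_one : 1 \ox 1 = 1 :> tensor A B. Proof. by []. Qed.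

End TensorFalgebra.

Section TensorMorphisms.
Context {k : fieldType}.

Section Map.
Context (A B A' B' : falgType k).
Context (f : {lrmorphism A -> A'}) (g : {lrmorphism B -> B'}).

Lemma tmap_tens a b : tmap f g (a \ox b) = f a \ox g b.
Proof. by rewrite /tmap tlift_tens //; multilin. Qed.

Fact tmap_is_monoid_morphism : monoid_morphism (tmap f g).
Proof.
split; first by rewrite -tens_one tmap_tens !rmorph1.
elim/(@tens_ind k A B) => [x s s' es es' t|a b].
  by rewrite mulPl !linearP /= es es' mulPl.
elim/(@tens_ind k A B) => [x s s' es es'|c d].
  by rewrite mulPr !linearP /= es es' mulPr.
by rewrite tensM !tmap_tens tensM !rmorphM.
Qed.
HB.instance Definition _ :=
  GRing.isMonoidMorphism.Build _ _ (tmap f g) tmap_is_monoid_morphism.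
End Map.

Section Assoc.
Context (A B C : falgType k).

Lemma tassoc_tens (a : A) (b : B) (c : C) :
  tassoc ((a \ox b) \ox c) = a \ox (b \ox c).
Proof.
rewrite /tassoc tlift_tens; first by rewrite tlift_tens //; multilin.
split=> [c' x s t|s x d d'] /=; first by rewrite linearP.
by rewrite -tliftP; apply: eq_tlift => y z; rewrite !multilinE.
Qed.

Fact tassoc_is_monoid_morphism : monoid_morphism (@tassoc k A B C).
Proof.
split; first by rewrite -!tens_one tassoc_tens.
elim/(@tens_ind k (tensor A B) C) => [x s s' es es' t|ab c].
  by rewrite mulPl !linearP /= es es' mulPl.
elim/(@tens_ind k (tensor A B) C) => [x s s' es es'|de f].
  by rewrite mulPr !linearP /= es es' mulPr.
elim/(@tens_ind k A B): ab => [x s s' es es'|a b].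
  by rewrite tensPl mulPl !linearP /= es es' mulPl.
elim/(@tens_ind k A B): de => [x s s' es es'|d e].
  by rewrite tensPl mulPr !linearP /= es es' mulPr.
by rewrite !(tensM, tassoc_tens).
Qed.
HB.instance Definition _ :=
  GRing.isMonoidMorphism.Build _ _ (@tassoc k A B C) tassoc_is_monoid_morphism.
End Assoc.

End TensorMorphisms.

Record hopfAlgType (k : fieldType) := HopfAlgebra {
  hopf_carrier :> falgType k;
  comul : {lrmorphism hopf_carrier -> tensor hopf_carrier hopf_carrier};
  counit : {lrmorphism hopf_carrier -> k^o};
  antipode : {linear hopf_carrier -> hopf_carrier};
  comulA : forall h,
    tassoc (tmap comul idfun (comul h)) = tmap idfun comul (comul h);
  comul_counitl : forall h,
    tlift (fun a b => (counit a : k) *: b) (comul h) = h;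
  comul_counitr : forall h,
    tlift (fun a b => (counit b : k) *: a) (comul h) = h;
  antipodel : forall h,
    tlift (fun a b => antipode a * b) (comul h) = (counit h : k) *: 1;
  antipoder : forall h,
    tlift (fun a b => a * antipode b) (comul h) = (counit h : k) *: 1
}.

Arguments comul {k H} : rename.
Arguments counit {k H} : rename.
Arguments antipode {k H} : rename.
Arguments comulA {k H} h : rename.
Arguments comul_counitl {k H} h : rename.
Arguments comul_counitr {k H} h : rename.
Arguments antipodel {k H} h : rename.
Arguments antipoder {k H} h : rename.

Section HopfTheory.
Context {k : fieldType} {H : hopfAlgType k}.
Implicit Types (a b h x : H) (s t F : tensor H H).
Local Notation S := (@antipode k H).
Local Notation Delta := (@comul k H).
Local Notation eps := (@counit k H).

Definition eps_l t : H := tlift (fun a b => (eps a : k) *: b) t.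
Definition eps_r t : H := tlift (fun a b => (eps b : k) *: a) t.
HB.instance Definition _ :=
  GRing.Linear.copy eps_l (tlift (fun a b => (eps a : k) *: b)).
HB.instance Definition _ :=
  GRing.Linear.copy eps_r (tlift (fun a b => (eps b : k) *: a)).

Lemma eps_l_tens a b : eps_l (a \ox b) = (eps a : k) *: b.
Proof. by rewrite /eps_l tlift_tens //; multilin. Qed.

Lemma eps_r_tens a b : eps_r (a \ox b) = (eps b : k) *: a.
Proof. by rewrite /eps_r tlift_tens //; multilin. Qed.

Fact eps_l_is_monoid_morphism : monoid_morphism eps_l.
Proof.
split; first by rewrite -tens_one eps_l_tens rmorph1 scale1r.
elim/(@tens_ind k H H) => [x s s' es es' t|a b].
  by rewrite mulPl !linearP /= es es' mulPl.
elim/(@tens_ind k H H) => [x s s' es es'|c d].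
  by rewrite mulPr !linearP /= es es' mulPr.
rewrite tensM !eps_l_tens rmorphM /= -scalerAl -scalerAr scalerA //.
Qed.
HB.instance Definition _ :=
  GRing.isMonoidMorphism.Build _ _ eps_l eps_l_is_monoid_morphism.

Fact eps_r_is_monoid_morphism : monoid_morphism eps_r.
Proof.
split; first by rewrite -tens_one eps_r_tens rmorph1 scale1r.
elim/(@tens_ind k H H) => [x s s' es es' t|a b].
  by rewrite mulPl !linearP /= es es' mulPl.
elim/(@tens_ind k H H) => [x s s' es es'|c d].
  by rewrite mulPr !linearP /= es es' mulPr.
rewrite tensM !eps_r_tens rmorphM /= -scalerAl -scalerAr scalerA //.
Qed.
HB.instance Definition _ :=
  GRing.isMonoidMorphism.Build _ _ eps_r eps_r_is_monoid_morphism.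

Lemma comulA_tlift (U : vectType k) (f : H -> H -> H -> U) h :
    (forall a, bilin (f a)) -> (forall b c, linear (fun a => f a b c)) ->
  tlift (fun x c => tlift (fun a b => f a b c) (Delta x)) (Delta h) =
  tlift (fun a y => tlift (f a) (Delta y)) (Delta h).
Proof.
move=> f2 f1; pose L := tlift (fun a t => tlift (f a) t).
have LE a b c : L (a \ox (b \ox c)) = f a b c.
  rewrite /L tlift_tens; first by rewrite tlift_tens.
  split=> [t z x y|x z s t] /=; last by rewrite linearP.
  by rewrite -tliftP; apply: eq_tlift => ? ?; apply: f1.
have e1 t : L (tassoc (tmap Delta idfun t)) =
    tlift (fun x c => L (tassoc (Delta x \ox c))) t.
  exact: (linear_tlift (L \o @tassoc k H H H)).
have e2 t : L (tmap idfun Delta t) = tlift (fun a y => L (a \ox Delta y)) t.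
  exact: (linear_tlift L).
transitivity (L (tassoc (tmap Delta idfun (Delta h)))).
  rewrite e1; apply: eq_tlift => x c; symmetry; rewrite /tassoc tlift_tens.
    transitivity (tlift (fun a b => L (a \ox (b \ox c))) (Delta x)).
      exact: (linear_tlift L).
    by apply: eq_tlift => a b; rewrite LE.
  split=> [c' z s t|s z d d'] /=; first by rewrite linearP.
  by rewrite -tliftP; apply: eq_tlift => ? ?; rewrite !multilinE.
rewrite comulA e2; apply: eq_tlift => a y.
rewrite /L tlift_tens //.
split=> [t z x x'|x z s t] /=; last by rewrite linearP.
by rewrite -tliftP; apply: eq_tlift => ? ?; apply: f1.
Qed.

(* [mulSl x t] is S(t') x t'' and [mulSr x t] is t' x S(t'').                 *)
Definition mulSl x t : H := tlift (fun a b => S a * x * b) t.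
Definition mulSr x t : H := tlift (fun a b => a * x * S b) t.

Lemma mulSlP x z s t : mulSl x (z *: s + t) = z *: mulSl x s + mulSl x t.
Proof. by rewrite /mulSl linearP. Qed.
Lemma mulSrP x z s t : mulSr x (z *: s + t) = z *: mulSr x s + mulSr x t.
Proof. by rewrite /mulSr linearP. Qed.
Lemma mulSlPx z x y t : mulSl (z *: x + y) t = z *: mulSl x t + mulSl y t.
Proof. by rewrite /mulSl -tliftP; apply: eq_tlift => *; rewrite !multilinE. Qed.
Lemma mulSrPx z x y t : mulSr (z *: x + y) t = z *: mulSr x t + mulSr y t.
Proof. by rewrite /mulSr -tliftP; apply: eq_tlift => *; rewrite !multilinE. Qed.
Lemma mulSl_tens x a b : mulSl x (a \ox b) = S a * x * b.
Proof. by rewrite /mulSl tlift_tens //; multilin. Qed.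
Lemma mulSr_tens x a b : mulSr x (a \ox b) = a * x * S b.
Proof. by rewrite /mulSr tlift_tens //; multilin. Qed.

Lemma mulSl_comul h : mulSl 1 (Delta h) = (eps h : k) *: 1.
Proof. by rewrite -antipodel; apply: eq_tlift => *; rewrite mulr1. Qed.
Lemma mulSr_comul h : mulSr 1 (Delta h) = (eps h : k) *: 1.
Proof. by rewrite -antipoder; apply: eq_tlift => *; rewrite mulr1. Qed.

Lemma antipode1 : S 1 = 1.
Proof.
have := mulSl_comul 1; rewrite rmorph1 -tens_one mulSl_tens !mulr1 => ->.
by rewrite rmorph1 scale1r.
Qed.

Lemma mulr_tlift (V W : vectType k) x (f : V -> W -> H)
    (t : tensor V W) :
  x * tlift f t = tlift (fun v w => x * f v w) t.
Proof. exact: (linear_tlift (x \*o idfun)). Qed.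

Lemma tlift_mulr (V W : vectType k) x (f : V -> W -> H)
    (t : tensor V W) :
  tlift f t * x = tlift (fun v w => f v w * x) t.
Proof. exact: (linear_tlift (x \o* idfun)). Qed.

Lemma mulSlM1 s t :
  mulSl 1 (s * t) =
  tlift (fun a1 a2 => tlift (fun b1 b2 => S (a1 * b1) * (a2 * b2)) t) s.
Proof.
transitivity (tlift (fun a1 a2 => mulSl 1 (tlift (fun b1 b2 =>
    (a1 * b1) \ox (a2 * b2)) t)) s).
  exact: (linear_tlift (tlift (fun a b => S a * 1 * b))).
apply: eq_tlift => a1 a2.
transitivity (tlift (fun b1 b2 => mulSl 1 ((a1 * b1) \ox (a2 * b2))) t).
  exact: (linear_tlift (tlift (fun a b => S a * 1 * b))).
by apply: eq_tlift => b1 b2; rewrite mulSl_tens mulr1.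
Qed.

Lemma antipodeM a b : S (a * b) = S b * S a.
Proof.
pose f a1 a2 a3 b1 b2 b3 := S (a1 * b1) * (a2 * b2 * (S b3 * S a3)).
pose K1 := tlift (fun a1 a' => tlift (fun a2 a3 => tlift (fun b1 b' =>
  tlift (f a1 a2 a3 b1) (Delta b')) (Delta b)) (Delta a')) (Delta a).
pose K2 := tlift (fun x a3 => tlift (fun a1 a2 => tlift (fun y b3 => tlift
  (fun b1 b2 => f a1 a2 a3 b1 b2 b3) (Delta y)) (Delta b)) (Delta x)) (Delta a).
have K21 : K2 = K1.
  rewrite /K2 comulA_tlift.
  - apply: eq_tlift => a1 a'; apply: eq_tlift => a2 a3.
    apply: comulA_tlift => [b1|b2 b3 z b1 b1'] /=; rewrite /f;
      first by multilin.
    by rewrite !(multilinE, linearP).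
  - move=> a1; split=> ? ? ? ? /=; rewrite -tliftP; apply: eq_tlift => ? ?;
      by rewrite -tliftP; apply: eq_tlift => ? ?;
      rewrite /f !(linearP, multilinE).
  - move=> a1 ? ? ? ? /=; rewrite -tliftP; apply: eq_tlift => ? ?;
      by rewrite -tliftP; apply: eq_tlift => ? ?;
      rewrite /f !(linearP, multilinE).
have -> : S (a * b) = K1.
  rewrite -{1}(comul_counitr a) tlift_mulr linear_tlift.
  apply: eq_tlift => a1 a'.
  transitivity (S (a1 * b) * mulSr 1 (Delta a')).
    by rewrite mulSr_comul -scalerAl linearZ /= -scalerAr mulr1.
  rewrite /mulSr mulr_tlift; apply: eq_tlift => a2 a3.
  rewrite -{1}(comul_counitr b) mulr_tlift linear_tlift tlift_mulr.
  apply: eq_tlift => b1 b'.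
  transitivity (S (a1 * b1) * (a2 * mulSr 1 (Delta b') * S a3)).
    rewrite mulSr_comul mulr1 -!scalerAr -!scalerAl linearZ /= mulr1.
    by rewrite -scalerAr -scalerAl.
  rewrite /mulSr mulr_tlift tlift_mulr mulr_tlift; apply: eq_tlift => b2 b3.
  by rewrite /f mulr1 !mulrA.
rewrite -K21 -[in RHS](comul_counitl a) linear_tlift mulr_tlift.
apply: eq_tlift => x a3; rewrite exchange_tlift.
rewrite -[in RHS](comul_counitl b) linear_tlift tlift_mulr.
apply: eq_tlift => y b3.
transitivity (mulSl 1 (Delta x * Delta y) * (S b3 * S a3)).
  rewrite mulSlM1 tlift_mulr; apply: eq_tlift => a1 a2.
  by rewrite tlift_mulr; apply: eq_tlift => b1 b2; rewrite /f !mulrA.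
rewrite -rmorphM mulSl_comul rmorphM !linearZ /= -scalerAl mul1r.
by rewrite -scalerAl -scalerAr scalerA mulrC.
Qed.
Lemma mulSlM x s t : mulSl x (s * t) = mulSl (mulSl x s) t.
Proof.
elim/(@tens_ind k H H): s => [z s s' es es'|a b].
  by rewrite mulPl !mulSlP es es' mulSlPx.
elim/(@tens_ind k H H): t => [z s s' es es'|c d].
  by rewrite mulPr !mulSlP es es'.
by rewrite tensM !mulSl_tens antipodeM !mulrA.
Qed.

Lemma mulSrM x s t : mulSr x (s * t) = mulSr (mulSr x t) s.
Proof.
elim/(@tens_ind k H H): t => [z s' t es et|c d].
  by rewrite mulPr !mulSrP es et mulSrPx.
elim/(@tens_ind k H H): s => [z s s' es es'|a b].
  by rewrite mulPl !mulSrP es es'.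
by rewrite tensM !mulSr_tens antipodeM !mulrA.
Qed.

Lemma mulSl1 : mulSl 1 1 = 1.
Proof. by rewrite -tens_one mulSl_tens antipode1 !mulr1. Qed.

Lemma mulSr1 : mulSr 1 1 = 1.
Proof. by rewrite -tens_one mulSr_tens antipode1 !mulr1. Qed.

Definition is_twist F : Prop :=
  [/\ F \is a GRing.unit, eps_l F = 1, eps_r F = 1 &
      tassoc ((F \ox 1) * tmap Delta idfun F) =
      (1 \ox F) * tmap idfun Delta F].

End HopfTheory.

Section Twist.
Context {k : fieldType} {H : hopfAlgType k}.
Variables (F : tensor H H) (twF : is_twist F).
Local Notation S := (@antipode k H).
Local Notation Delta := (@comul k H).
Local Notation eps := (@counit k H).
Local Notation G := (F^-1).

Let unitF : F \is a GRing.unit. Proof. by case: twF. Qed.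
Let epslF : eps_l F = 1. Proof. by case: twF. Qed.
Let epsrF : eps_r F = 1. Proof. by case: twF. Qed.
Let epslG : eps_l G = 1. Proof. by rewrite rmorphV //= epslF invr1. Qed.
Let epsrG : eps_r G = 1. Proof. by rewrite rmorphV //= epsrF invr1. Qed.

Definition twist_comul (h : H) : tensor H H := F * Delta h * F^-1.

Fact twist_comul_is_linear : linear twist_comul.
Proof. by move=> z x y; rewrite /twist_comul linearP mulPr mulPl. Qed.
HB.instance Definition _ :=
  GRing.isLinear.Build _ _ _ _ twist_comul twist_comul_is_linear.

Fact twist_comul_is_monoid_morphism : monoid_morphism twist_comul.
Proof.
split=> [|x y]; first by rewrite /twist_comul rmorph1 mulr1 divrr.
rewrite /twist_comul rmorphM /= -!mulrA; do 2 congr (_ * _).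
by rewrite mulrA mulVr // mul1r.
Qed.
HB.instance Definition _ :=
  GRing.isMonoidMorphism.Build _ _ twist_comul twist_comul_is_monoid_morphism.

(* With F = F' \ox F'' and F^-1 = G' \ox G'', [twist_u] is F' S(F'') and      *)
(* [twist_v], its inverse, is S(G') G''.                                      *)
Definition twist_u : H := tlift (fun a b => a * S b) F.
Definition twist_v : H := tlift (fun a b => S a * b) F^-1.

Let uE : twist_u = mulSr 1 F.
Proof. by apply: eq_tlift => *; rewrite mulr1. Qed.
Let vE : twist_v = mulSl 1 G.
Proof. by apply: eq_tlift => *; rewrite mulr1. Qed.

Definition twist_antipode (h : H) : H := twist_u * S h * twist_v.

Fact twist_antipode_is_linear : linear twist_antipode.
Proof. by move=> z x y; rewrite /twist_antipode linearP mulPr mulPl. Qed.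
HB.instance Definition _ :=
  GRing.isLinear.Build _ _ _ _ twist_antipode twist_antipode_is_linear.

Lemma tensl_unit : (F \ox 1) * (G \ox 1) = 1 :> tensor (tensor H H) H.
Proof. by rewrite tensM divrr // mulr1. Qed.

Lemma tensr_unit : (1 \ox F) * (1 \ox G) = 1 :> tensor H (tensor H H).
Proof. by rewrite tensM divrr // mulr1. Qed.

Lemma tensr_unitV : (1 \ox G) * (1 \ox F) = 1 :> tensor H (tensor H H).
Proof. by rewrite tensM mulVr // mulr1. Qed.

Lemma tmap_twistl (t : tensor H H) : tmap twist_comul (@idfun H) t =
  (F \ox 1) * tmap Delta idfun t * (G \ox 1).
Proof.
elim/(@tens_ind k H H): t => [z s s' es es'|a b].
  by rewrite !linearP /= es es' mulPr mulPl.
by rewrite !tmap_tens /= !tensM mul1r mulr1.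
Qed.

Lemma tmap_twistr (t : tensor H H) : tmap (@idfun H) twist_comul t =
  (1 \ox F) * tmap idfun Delta t * (1 \ox G).
Proof.
elim/(@tens_ind k H H): t => [z s s' es es'|a b].
  by rewrite !linearP /= es es' mulPr mulPl.
by rewrite !tmap_tens /= !tensM mul1r mulr1.
Qed.

Fact twist_comulA h :
  tassoc (tmap twist_comul idfun (twist_comul h)) =
  tmap idfun twist_comul (twist_comul h).
Proof.
have [_ _ _ eqF] := twF.
rewrite tmap_twistl tmap_twistr /twist_comul !rmorphM /=.
set X := tassoc (F \ox 1); set Y := tassoc (tmap _ _ F).
have XY : X * Y = (1 \ox F) * tmap idfun Delta F by rewrite -eqF rmorphM.
rewrite comulA !mulrA XY -!mulrA; do 3 congr (_ * _).
set Y' := tassoc _; set X' := tassoc _; set D' := tmap _ _ _; set C' := _ \ox _.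
have YY' : Y * Y' = 1.
  rewrite -[LHS]rmorphM /= -rmorphM /= divrr //.
  by rewrite (rmorph1 (tmap Delta idfun)) rmorph1.
have XX' : X * X' = 1 by rewrite -[LHS]rmorphM /= tensl_unit rmorph1.
have D'D : D' * tmap idfun Delta F = 1.
  by rewrite -[LHS]rmorphM /= mulVr // (rmorph1 (tmap idfun Delta)).
have e1 : (X * Y) * (Y' * X') = 1.
  by rewrite mulrA -[X * Y * Y']mulrA YY' mulr1.
have e2 : (D' * C') * (X * Y) = 1.
  by rewrite XY mulrA -[D' * C' * _]mulrA tensr_unitV mulr1.
by rewrite -[RHS]mulr1 -e1 mulrA e2 mul1r.
Qed.

Fact twist_comul_counitl h :
  tlift (fun a b => (eps a : k) *: b) (twist_comul h) = h.
Proof.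
rewrite -[LHS]/(eps_l _) /twist_comul !rmorphM /= epslF epslG mul1r mulr1.
exact: comul_counitl.
Qed.

Fact twist_comul_counitr h :
  tlift (fun a b => (eps b : k) *: a) (twist_comul h) = h.
Proof.
rewrite -[LHS]/(eps_r _) /twist_comul !rmorphM /= epsrF epsrG mul1r mulr1.
exact: comul_counitr.
Qed.

(* a \ox b \ox c |-> a S(b) c *)
Let theta : tensor H (tensor H H) -> H :=
  tlift (fun a t => a * tlift (fun b c => S b * c) t).

Let theta_tens a b c : theta (a \ox (b \ox c)) = a * S b * c.
Proof.
rewrite /theta tlift_tens; last by multilin.
by rewrite tlift_tens ?mulrA //; multilin.
Qed.

Let thetaP z s t : theta (z *: s + t) = z *: theta s + theta t.
Proof. by rewrite /theta linearP. Qed.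

Let theta_comul t s : theta (tmap idfun Delta t * s) = eps_r t * theta s.
Proof.
elim/(@tens_ind k H H): t => [z t t' es es'|a h].
  by rewrite !linearP /= !mulPl thetaP es es'.
rewrite tmap_tens eps_r_tens /=.
elim/(@tens_ind k H (tensor H H)): s => [z s s' es es'|b s].
  by rewrite mulPr !thetaP mulPr es es'.
elim/(@tens_ind k H H): s => [z s s' es es'|c d].
  by rewrite tensPr mulPr !thetaP mulPr es es'.
rewrite tensM theta_tens.
transitivity (a * b * S c * mulSl 1 (Delta h) * d).
  elim/(@tens_ind k H H): (Delta h) => [z s s' es es'|x y].
    by rewrite mulPl tensPr thetaP es es' mulSlP mulPr mulPl.
  by rewrite tensM theta_tens antipodeM mulSl_tens !mulr1 !mulrA.
by rewrite mulSl_comul -scalerAr mulr1 -!scalerAl !mulrA.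
Qed.

Let theta_comull t : theta (tassoc (tmap Delta idfun t)) = eps_l t.
Proof.
elim/(@tens_ind k H H): t => [z s s' es es'|h c].
  by rewrite !linearP /= thetaP es es'.
rewrite tmap_tens eps_l_tens /=.
transitivity (mulSr 1 (Delta h) * c).
  elim/(@tens_ind k H H): (Delta h) => [z s s' es es'|x y].
    by rewrite tensPl linearP /= thetaP es es' mulSrP mulPl.
  by rewrite tassoc_tens theta_tens mulSr_tens mulr1.
by rewrite mulSr_comul -scalerAl mul1r.
Qed.

Lemma twist_uv : twist_u * twist_v = 1.
Proof.
have [_ _ _ eqF] := twF.
have e : (1 \ox G) * tassoc (F \ox 1) =
    tmap idfun Delta F * tassoc (tmap Delta idfun G).
  have -> : tassoc (F \ox 1) =
      tassoc ((F \ox 1) * tmap Delta idfun F) * tassoc (tmap Delta idfun G).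
    by rewrite -rmorphM -mulrA -rmorphM divrr // rmorph1 mulr1.
  by rewrite eqF !mulrA tensr_unitV mul1r.
transitivity (theta ((1 \ox G) * tassoc (F \ox 1))); last first.
  by rewrite e theta_comul theta_comull epsrF epslG mulr1.
rewrite uE vE; move: (F^-1) => G'; move: (F) => F'.
elim/(@tens_ind k H H): F' => [z s s' es es'|a b].
  by rewrite mulSrP mulPl es es' tensPl linearP /= mulPr thetaP.
elim/(@tens_ind k H H): G' => [z s s' es es'|c d].
  by rewrite mulSlP mulPr es es' tensPr mulPl thetaP.
rewrite tassoc_tens !tensM theta_tens mulSr_tens mulSl_tens antipodeM.
by rewrite !mulr1 mul1r !mulrA.
Qed.

Fact twist_antipodel h :
  tlift (fun a b => twist_antipode a * b) (twist_comul h) = (eps h : k) *: 1.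
Proof.
transitivity (twist_u * mulSl twist_v (twist_comul h)).
  by rewrite /mulSl mulr_tlift; apply: eq_tlift => *; rewrite !mulrA.
have vF : mulSl twist_v F = 1 by rewrite vE -mulSlM mulVr // mulSl1.
rewrite /twist_comul !mulSlM vF mulSl_comul.
rewrite -[X in mulSl X _]addr0 mulSlPx -vE.
have -> : mulSl 0 G = 0.
  by apply: big1 => i _; apply: big1 => j _; rewrite mulr0 mul0r scaler0.
by rewrite addr0 -scalerAr twist_uv.
Qed.

Fact twist_antipoder h :
  tlift (fun a b => a * twist_antipode b) (twist_comul h) = (eps h : k) *: 1.
Proof.
transitivity (mulSr twist_u (twist_comul h) * twist_v).
  by rewrite /mulSr tlift_mulr; apply: eq_tlift => *; rewrite !mulrA.
have uG : mulSr twist_u G = 1 by rewrite uE -mulSrM mulVr // mulSr1.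
rewrite /twist_comul !mulSrM uG mulSr_comul.
rewrite -[X in mulSr X _]addr0 mulSrPx -uE.
have -> : mulSr 0 F = 0.
  by apply: big1 => i _; apply: big1 => j _; rewrite mulr0 mul0r scaler0.
by rewrite addr0 -scalerAl twist_uv.
Qed.

(* The algebra H with comultiplication F Delta F^-1 and the same counit; the *)
(* antipode, determined by these, is h |-> twist_u S(h) twist_v.              *)
Definition twist_hopf : hopfAlgType k :=
  @HopfAlgebra k H twist_comul (@counit k H) twist_antipode
    twist_comulA twist_comul_counitl twist_comul_counitr
    twist_antipodel twist_antipoder.

End Twist.

Definition hopf_iso (k : fieldType) (H H' : hopfAlgType k)
    (f : {lrmorphism H -> H'}) : Prop :=
  [/\ bijective f,
      forall h, comul (f h) = tmap f f (comul h),
      forall h, counit (f h) = counit h &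
      forall h, antipode (f h) = f (antipode h)].

Definition hopf_isomorphic (k : fieldType) (H H' : hopfAlgType k) : Prop :=
  exists f : {lrmorphism H -> H'}, hopf_iso f.

Definition gauge_equivalent (k : fieldType) (H H' : hopfAlgType k) : Prop :=
  exists (F : tensor H H) (twF : is_twist F),
    hopf_isomorphic H' (twist_hopf twF).

Section Indicators.
Context {k : fieldType}.

Definition lfun_trace (V : vectType k) (f : 'End(V)) : k :=
  \tr (passmx.mxof (vbasis {:V}) (vbasis {:V}) f).

Context (H : hopfAlgType k).

Definition conv (f g : 'End(H)) : 'End(H) :=
  linfun (tlift (fun a b => f a * g b) \o comul).

Definition conv1 : 'End(H) := linfun (fun h => (counit h : k) *: (1 : H)).

Lemma convE f g h :
  conv f g h = tlift (fun a b => f a * g b) (comul h).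
Proof. by rewrite lfunE. Qed.

Lemma conv1E h : conv1 h = (counit h : k) *: 1.
Proof.
have lin : linear (fun h : H => (counit h : k) *: (1 : H)).
  by move=> z x y; rewrite linearP /= scalePl.
pose L : {linear H -> H} := HB.pack (fun h : H => (counit h : k) *: (1 : H))
  (GRing.isLinear.Build _ _ _ _ _ lin).
exact: (lfunE L).
Qed.

Definition conv_exp (f : 'End(H)) (m : nat) : 'End(H) := iter m (conv f) conv1.

(* [antipode] being the convolution inverse of the identity, this is the m-th *)
(* convolution power of the identity for every integer m.                     *)
Definition sweedler_power (m : int) : 'End(H) :=
  match m with
  | Posz p => conv_exp \1%VF p
  | Negz p => conv_exp (linfun antipode) p.+1
  end.

Definition nu (n : int) : k :=
  lfun_trace (linfun antipode \o sweedler_power (n - 1))%VF.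

End Indicators.

(* Main.v *)
(* Write F = F' \ox F'', F^-1 = G' \ox G'', and put                           *)
(*   Phi(q)(h) = G' q(F' h G'') F''   for q in End(H),                        *)
(* with independent copies of F and F^-1.  Since the antipode of H_F is       *)
(* h |-> F' S(F'') S(h) S(G') G'', cyclicity of the trace gives               *)
(* Tr(S_F o q) = Tr(S o Phi(q)), so it is enough that Phi maps the m-th       *)
(* Sweedler power of H_F to that of H.  If p = Phi(q) satisfies               *)
(*   a_1 p(h a_2) = p(a_1 h) a_2                                              *)
(* (as all Sweedler powers of H do), then one use of the cocycle identity     *)
(* of F and F^-1 F = 1 give Phi(id *_F q) = id * p.  This settles m >= 0; for *)
(* m < 0, invert: Phi is bijective and id is convolution invertible.          *)

From HB Require Import structures.
Require Import Defs.
From mathcomp Require Import all_boot all_algebra falgebra.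

Set Implicit Arguments.
Unset Strict Implicit.
Unset Printing Implicit Defensive.

Import GRing.Theory.
Local Open Scope ring_scope.

(** An isomorphism f intertwines the maps S o P^(n-1), so it preserves their traces ([nu_hopf_iso]);
    this reduces the theorem to K = H_F. There Phi is [sandwich F F^-1]. [trace_twist_antipode]
    trades the antipode of K for that of H at the price of applying Phi, and
    [sandwich_sweedler_power] shows that Phi undoes the twisting of each Sweedler power. The latter
    is an induction on the exponent that also carries [comul_central]. Each step multiplies by id
    ([sandwich_conv_id]) or by S ([sandwich_conv_antipode]), the second being deduced from the
    first. *)

Ltac tlift_bilin :=
  split=> ? ? ? ? /=;
  do ?(rewrite -tliftP; apply: eq_tlift => ? ? /=);
  do ?[rewrite linearP /=]; rewrite ?multilinE //;
  do ?[rewrite linearP /=]; rewrite ?multilinE //.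

(** * Linearity and cyclicity of the trace *)

Section Trace.
Context {k : fieldType}.

Lemma lfun_trace_is_linear (V : vectType k) :
  linear (@lfun_trace k V : 'End(V) -> k^o).
Proof.
by move=> z f g; rewrite /lfun_trace passmx.mxof_linear mxtraceD mxtraceZ.
Qed.
HB.instance Definition _ (V : vectType k) :=
  GRing.isLinear.Build k 'End(V) k^o _ (@lfun_trace k V)
    (@lfun_trace_is_linear V).

Lemma lfun_trace_comp (V W : vectType k) (f : 'Hom(V, W)) (g : 'Hom(W, V)) :
  lfun_trace (g \o f)%VF = lfun_trace (f \o g)%VF.
Proof.
rewrite /lfun_trace (passmx.mxof_comp _ _ (vbasisP {:W})).
by rewrite (passmx.mxof_comp _ _ (vbasisP {:V})) mxtrace_mulC.
Qed.

End Trace.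

(** * Calculus of bilinear sums over tensors *)

Section TensorLift.
Context {k : fieldType}.

Lemma tlift_lfunE (V W U U' : vectType k) (f : V -> W -> 'Hom(U, U')) t x :
  tlift f t x = tlift (fun v w => f v w x) t.
Proof.
rewrite /tlift sum_lfunE; apply: eq_bigr => i _; rewrite sum_lfunE.
by apply: eq_bigr => j _; rewrite scale_lfunE.
Qed.

Lemma lfun_trace_tlift (V W U : vectType k) (f : V -> W -> 'End(U)) t :
  lfun_trace (tlift f t) =
  tlift (U := k^o) (fun v w => lfun_trace (f v w)) t.
Proof. exact: (linear_tlift (@lfun_trace k U : {linear _ -> k^o})). Qed.

Lemma tliftM (A B : falgType k) (U : vectType k) (f : A -> B -> U)
    (s t : tensor A B) :
  bilin f ->
  tlift f (s * t) = tlift (fun a b => tlift (fun c d => f (a * c) (b * d)) t) s.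
Proof.
move=> fP; rewrite -[s * t]/(tens_mul s t) /tens_mul linear_tlift.
apply: eq_tlift => a b; rewrite linear_tlift.
by apply: eq_tlift => c d /=; rewrite tlift_tens.
Qed.

Lemma falg_mulr_tlift (A : falgType k) (V W : vectType k) x
    (f : V -> W -> A) t :
  x * tlift f t = tlift (fun v w => x * f v w) t.
Proof. exact: (linear_tlift (x \*o idfun)). Qed.

Lemma falg_tlift_mulr (A : falgType k) (V W : vectType k) x
    (f : V -> W -> A) t :
  tlift f t * x = tlift (fun v w => f v w * x) t.
Proof. exact: (linear_tlift (x \o* idfun)). Qed.

End TensorLift.

(** * The maps Phi and their composition *)

Section Sandwich.
Context {k : fieldType} {A : falgType k}.
Implicit Types (s t : tensor A A) (q : 'End(A)).

(* In Sweedler notation, [sandwich s t q h] is t' q(s' h t'') s''.            *)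
Definition sandwich s t q : 'End(A) :=
  tlift (fun c d => tlift (fun a b =>
    amull c \o (amulr b \o (q \o (amull a \o amulr d))))%VF s) t.

Lemma sandwichE s t q h :
  sandwich s t q h =
  tlift (fun c d => tlift (fun a b => c * q (a * h * d) * b) s) t.
Proof.
rewrite tlift_lfunE; apply: eq_tlift => c d; rewrite tlift_lfunE.
by apply: eq_tlift => a b; rewrite !(comp_lfunE, lfunE) /= !mulrA.
Qed.

(** The inner legs nest outwards around q, so the second tensors multiply in order and the first in
    reverse order. With [sandwich1], this makes [sandwich F^-1 F] the inverse of Phi. *)
Lemma sandwich_comp s t s' t' q :
  sandwich s t (sandwich s' t' q) = sandwich (s' * s) (t * t') q.
Proof.
apply/lfunP=> h; rewrite !sandwichE tliftM; last by tlift_bilin.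
apply: eq_tlift => c d.
transitivity (tlift (fun a b => tlift (fun c' d' => tlift (fun a' b' =>
  c * c' * q (a' * a * h * (d * d')) * (b' * b)) s') t') s).
  apply: eq_tlift => a b.
  rewrite sandwichE falg_mulr_tlift falg_tlift_mulr; apply: eq_tlift => c' d'.
  rewrite falg_mulr_tlift falg_tlift_mulr; apply: eq_tlift => a' b'.
  by rewrite !mulrA.
rewrite exchange_tlift; apply: eq_tlift => c' d'; rewrite exchange_tlift.
by rewrite tliftM //; tlift_bilin.
Qed.

Lemma sandwich1 q : sandwich 1 1 q = q.
Proof.
apply/lfunP=> h; rewrite sandwichE -tens_one tlift_tens; last by tlift_bilin.
by rewrite tlift_tens ?mul1r ?mulr1 //; tlift_bilin.
Qed.

End Sandwich.

(** * Convolution by id and by the antipode; [comul_central] maps *)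

Section Convolution.
Context {k : fieldType} {H : hopfAlgType k}.
Implicit Types (p q : 'End(H)) (a h : H).
Local Notation S := (linfun (@antipode k H)).
Local Notation I := (\1%VF : 'End(H)).

(** S * id is the convolution unit, stated as a cancellation rule so that associativity and the unit
    law are built in. *)
Lemma conv_antipodeK q : conv S (conv I q) = q.
Proof.
apply/lfunP=> h; rewrite convE.
transitivity (tlift (fun x y => tlift (fun b c => antipode x * b * q c)
  (comul y)) (comul h)).
  apply: eq_tlift => x y; rewrite convE mulr_tlift.
  by apply: eq_tlift => b c; rewrite !lfunE /= mulrA.
rewrite -comulA_tlift; [|by move=> ?; tlift_bilin|]; last first.
  by move=> ? ? ? ? ? /=; rewrite linearP !multilinE.
transitivity (tlift (fun x c => (counit x : k) *: q c) (comul h)).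
  apply: eq_tlift => x c.
  by rewrite -tlift_mulr antipodel -scalerAl mul1r.
by rewrite -[in RHS](comul_counitl h) linear_tlift; apply: eq_tlift => x c;
  rewrite linearZ.
Qed.

Lemma conv_idK q : conv I (conv S q) = q.
Proof.
apply/lfunP=> h; rewrite convE.
transitivity (tlift (fun x y => tlift (fun b c => x * antipode b * q c)
  (comul y)) (comul h)).
  apply: eq_tlift => x y; rewrite convE mulr_tlift.
  by apply: eq_tlift => b c; rewrite !lfunE /= mulrA.
rewrite -comulA_tlift; [|by move=> ?; tlift_bilin|]; last first.
  by move=> ? ? ? ? ? /=; rewrite !multilinE.
transitivity (tlift (fun x c => (counit x : k) *: q c) (comul h)).
  apply: eq_tlift => x c.
  by rewrite -tlift_mulr antipoder -scalerAl mul1r.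
by rewrite -[in RHS](comul_counitl h) linear_tlift; apply: eq_tlift => x c;
  rewrite linearZ.
Qed.

(** For the m-th power of id with m >= 1, both sides are a_1 h_1 a_2 h_2 ... a_m h_m a_(m+1). *)
Definition comul_central p := forall a h,
  tlift (fun x y => x * p (h * y)) (comul a) =
  tlift (fun x y => p (x * h) * y) (comul a).

Lemma conv_mul p q a h : conv p q (a * h) =
  tlift (fun x y => tlift (fun b c => p (x * b) * q (y * c)) (comul h))
    (comul a).
Proof. by rewrite convE rmorphM tliftM //; tlift_bilin. Qed.

Lemma comul_central_conv1 : comul_central (conv1 H).
Proof.
move=> a h; transitivity ((counit h : k) *: a).
  rewrite -[in RHS](comul_counitr a) -tliftZ; apply: eq_tlift => x y.
  by rewrite conv1E rmorphM -scalerAr mulr1 -scalerA.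
rewrite -[in LHS](comul_counitl a) -tliftZ; apply: eq_tlift => x y.
by rewrite conv1E rmorphM -scalerAl mul1r mulrC -scalerA.
Qed.

(** a_1 h_1 a_2 q(h_2 a_3) = a_1 h_1 q(a_2 h_2) a_3, by the hypothesis on q applied to the last two
    factors of a. *)
Lemma comul_central_conv_id q : comul_central q -> comul_central (conv I q).
Proof.
move=> Cq a h.
pose f (h1 h2 x y z : H) := x * h1 * (y * q (h2 * z)).
pose g (h1 h2 x y z : H) := x * h1 * (q (y * h2) * z).
transitivity (tlift (fun h1 h2 => tlift (fun x y =>
    tlift (f h1 h2 x) (comul y)) (comul a)) (comul h)).
  rewrite exchange_tlift; apply: eq_tlift => x y.
  rewrite conv_mul mulr_tlift; apply: eq_tlift => h1 h2.
  by rewrite mulr_tlift; apply: eq_tlift => b c; rewrite !lfunE /= /f !mulrA.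
transitivity (tlift (fun h1 h2 => tlift (fun x y =>
    tlift (g h1 h2 x) (comul y)) (comul a)) (comul h)).
  apply: eq_tlift => h1 h2; apply: eq_tlift => x y.
  by rewrite -!mulr_tlift Cq.
transitivity (tlift (fun h1 h2 => tlift (fun y z =>
    tlift (fun x y => g h1 h2 x y z) (comul y)) (comul a)) (comul h)).
  apply: eq_tlift => h1 h2; rewrite comulA_tlift //.
    by move=> ?; rewrite /g; tlift_bilin.
  by move=> ? ? ? ? ? /=; rewrite /g !multilinE.
rewrite exchange_tlift; apply: eq_tlift => x y.
rewrite conv_mul exchange_tlift tlift_mulr; apply: eq_tlift => h1 h2.
rewrite tlift_mulr; apply: eq_tlift => b c.
by rewrite /g !lfunE /= !mulrA.
Qed.

(** Both sides equal S(h_1) q(h_2 a). On the left a_1 S(a_2) cancels at once; on the right S(a_1)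
    a_2 cancels after the hypothesis on q turns q(a_2 h_2) a_3 into a_2 q(h_2 a_3). *)
Lemma comul_central_conv_antipode q :
  comul_central q -> comul_central (conv S q).
Proof.
move=> Cq a h.
transitivity (tlift (fun h1 h2 => antipode h1 * q (h2 * a)) (comul h)).
  transitivity (tlift (fun h1 h2 => tlift (fun x y =>
      tlift (fun b c => x * antipode b * (antipode h1 * q (h2 * c)))
        (comul y)) (comul a)) (comul h)).
    rewrite exchange_tlift; apply: eq_tlift => x y.
    rewrite conv_mul mulr_tlift; apply: eq_tlift => h1 h2.
    rewrite mulr_tlift; apply: eq_tlift => b c.
    by rewrite lfunE /= antipodeM !mulrA.
  apply: eq_tlift => h1 h2; rewrite -comulA_tlift; last 2 first.
  - by move=> ?; tlift_bilin.
  - by move=> ? ? ? ? ? /=; rewrite !multilinE.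
  rewrite -[in RHS](comul_counitl a) mulr_tlift linear_tlift mulr_tlift.
  apply: eq_tlift => x y.
  by rewrite -tlift_mulr antipoder -scalerAl mul1r -scalerAr linearZ -scalerAr.
symmetry; transitivity (tlift (fun h1 h2 => tlift (fun x y =>
    tlift (fun b c => antipode h1 * antipode x * (b * q (h2 * c)))
      (comul y)) (comul a)) (comul h)).
  transitivity (tlift (fun h1 h2 => tlift (fun x y =>
      tlift (fun b c => antipode h1 * antipode x * (q (b * h2) * c))
        (comul y)) (comul a)) (comul h)).
    transitivity (tlift (fun h1 h2 => tlift (fun x c =>
        tlift (fun x b => antipode h1 * antipode x * (q (b * h2) * c))
          (comul x)) (comul a)) (comul h)).
      rewrite exchange_tlift; apply: eq_tlift => x y.
      rewrite conv_mul exchange_tlift tlift_mulr; apply: eq_tlift => h1 h2.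
      rewrite tlift_mulr; apply: eq_tlift => b c.
      by rewrite lfunE /= antipodeM !mulrA.
    apply: eq_tlift => h1 h2; rewrite comulA_tlift //.
      by move=> ?; tlift_bilin.
    by move=> ? ? ? ? ? /=; rewrite linearP !multilinE.
  apply: eq_tlift => h1 h2; apply: eq_tlift => x y.
  by rewrite -!mulr_tlift Cq.
apply: eq_tlift => h1 h2.
transitivity (tlift (fun x y => tlift (fun b c =>
    antipode h1 * (antipode x * b * q (h2 * c))) (comul y)) (comul a)).
  by apply: eq_tlift => x y; apply: eq_tlift => b c; rewrite !mulrA.
rewrite -comulA_tlift; last 2 first.
- by move=> ?; tlift_bilin.
- by move=> ? ? ? ? ? /=; rewrite linearP !multilinE.
rewrite -[in RHS](comul_counitl a) mulr_tlift linear_tlift mulr_tlift.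
apply: eq_tlift => x y.
rewrite -mulr_tlift -tlift_mulr antipodel -scalerAl mul1r.
by rewrite -[in RHS]scalerAr linearZ.
Qed.

End Convolution.

(** * Invariance under twisting *)

Section TwistIndicators.
Context {k : fieldType} {H : hopfAlgType k}.
Variables (F : tensor H H) (twF : is_twist F).
Local Notation G := (F^-1).
Local Notation K := (twist_hopf twF).
Local Notation Delta := (@comul k H).
Implicit Types (p q : 'End(H)) (h : H).

(** As S reverses products, S_F(q(h)) = F' S(G' q(h) F'') G''; cyclicity moves the outer
    multiplications by F' and G'' onto the argument of q. *)
Lemma trace_twist_antipode q :
  lfun_trace (linfun (@antipode k K) \o q)%VF =
  lfun_trace (linfun (@antipode k H) \o sandwich F G q)%VF.
Proof.
pose f (b c : H) : 'End(H) := (linfun (@antipode k H) \o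
  (amull c \o (amulr b \o q)))%VF.
pose g (a d : H) : 'End(H) := (amull a \o amulr d)%VF.
have -> : (linfun (@antipode k K) \o q)%VF =
    tlift (fun c d => tlift (fun a b => (g a d \o f b c)%VF) F) G.
  apply/lfunP=> h; rewrite comp_lfunE lfunE /= /twist_antipode tlift_lfunE.
  rewrite /twist_v mulr_tlift; apply: eq_tlift => c d.
  rewrite tlift_lfunE /twist_u !tlift_mulr; apply: eq_tlift => a b.
  by rewrite !(comp_lfunE, lfunE) /= !antipodeM !mulrA.
have -> : (linfun (@antipode k H) \o sandwich F G q)%VF =
    tlift (fun c d => tlift (fun a b => (f b c \o g a d)%VF) F) G.
  apply/lfunP=> h; rewrite comp_lfunE lfunE /= sandwichE !tlift_lfunE.
  rewrite linear_tlift; apply: eq_tlift => c d.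
  rewrite tlift_lfunE linear_tlift; apply: eq_tlift => a b.
  by rewrite !(comp_lfunE, lfunE) /= !mulrA.
rewrite !lfun_trace_tlift; apply: (@eq_tlift k _ _ k^o) => c d.
by rewrite !lfun_trace_tlift; apply: (@eq_tlift k _ _ k^o) => a b;
  apply: (lfun_trace_comp (f b c) (g a d)).
Qed.

Lemma sandwich_conv_id q :
  comul_central (sandwich F G q) ->
  sandwich F G (@conv k K \1%VF q) = @conv k H \1%VF (sandwich F G q).
Proof.
set p := sandwich F G q => Cp; have [unitF _ _ eqF] := twF.
apply/lfunP=> h; rewrite sandwichE convE.
(* [N c e] maps x \ox y \ox z to c x e' q(y e'') z, and [L] maps x \ox y to   *)
(* x (id * p)(h y): the claim is that Phi(id *_F q)(h) = L(F^-1 F).           *)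
pose M r (t : tensor H H) : H := tlift (fun x y => x * (r : 'End(H)) y) t.
pose N c e (t : tensor H (tensor H H)) : H :=
  tlift (fun x w => tlift (fun y z => c * M q ((x \ox y) * e) * z) w) t.
pose L t : H := tlift (fun x y => x * M p (Delta (h * y))) t.
have Nlin c e z s t : N c e (z *: s + t) = z *: N c e s + N c e t.
  by rewrite /N linearP.
have ME r x y s : M r ((x \ox y) * s) =
    tlift (fun a b => x * a * r (y * b)) s.
  rewrite /M tliftM; last by tlift_bilin.
  by rewrite tlift_tens //; tlift_bilin.
have ND e c t b : N c e (tassoc (t \ox b)) = c * M q (t * e) * b.
  elim/(@tens_ind k H H): t => [z s t es et|x y].
    by rewrite tensPl linearP Nlin es et mulPl /M linearP mulPr mulPl.
  rewrite tassoc_tens /N tlift_tens; last by rewrite /M; tlift_bilin.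
  by rewrite tlift_tens // /M; tlift_bilin.
(* Two copies of F occur: the one in the twisted comultiplication stays fixed, while the one from
   Phi becomes the variable [t], open to induction by linearity. At t = F the argument of [N] is one
   side of the cocycle identity; [e2] starts from the other. *)
have e1 c d t : tlift (fun a b => c * M q (F * Delta (a * h * d) * G) * b) t =
    N c (Delta (h * d) * G) (tassoc ((F \ox 1) * tmap Delta idfun t)).
  elim/(@tens_ind k H H): t => [z s t es et|a b].
    rewrite [LHS]linearP /= es et [tmap _ _ (_ + _)]linearP /= mulPr.
    by rewrite [tassoc (_ + _)]linearP Nlin.
  rewrite tlift_tens; last first.
    rewrite /M; split=> [w z x y|w z x y] /=.
      by rewrite !mulPl linearP !(mulPr, mulPl) linearP !(mulPr, mulPl).
    by rewrite mulPr.
  by rewrite tmap_tens tensM mul1r ND -[a * h * d]mulrA rmorphM /= !mulrA.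
(* The fixed F and the inner F^-1 now surround q and form p; centrality of p then turns p(b_1 y) b_2
   into b_1 p(y b_2), which rebuilds the coproduct of h d b. *)
have e2 c d t : N c (Delta (h * d) * G) ((1 \ox F) * tmap idfun Delta t) =
    tlift (fun a b => L ((c * a) \ox (d * b))) t.
  elim/(@tens_ind k H H): t => [z s t es et|a b].
    by rewrite [RHS]linearP /= -es -et [tmap _ _ (_ + _)]linearP /= mulPr Nlin.
  rewrite tlift_tens; last by rewrite /L; tlift_bilin.
  rewrite tmap_tens tensM mul1r.
  rewrite /L tlift_tens; last by rewrite /M; tlift_bilin.
  rewrite [h * (d * b)]mulrA [Delta (_ * b)]rmorphM [M p _]tliftM;
    last by tlift_bilin.
  rewrite /N tlift_tens; last by rewrite /M; tlift_bilin.
  rewrite tliftM; last by rewrite /M; tlift_bilin.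
  rewrite exchange_tlift.
  transitivity (tlift (fun b1 b2 => tlift (fun d1 d2 => tlift (fun g1 g2 =>
    tlift (fun y z => c * a * d1 * (g1 * q (y * (b1 * d2) * g2) * z) * b2)
       F) G) (Delta (h * d))) (Delta b)).
    apply: eq_tlift => b1 b2.
    transitivity (tlift (fun y z => tlift (fun d1 d2 => tlift (fun g1 g2 =>
      c * a * d1 * (g1 * q (y * (b1 * d2) * g2) * z) * b2)
         G) (Delta (h * d))) F).
      apply: eq_tlift => y z; rewrite ME tliftM; last by tlift_bilin.
      rewrite mulr_tlift !tlift_mulr; apply: eq_tlift => d1 d2.
      rewrite mulr_tlift !tlift_mulr; apply: eq_tlift => g1 g2.
      by rewrite /= !mulrA.
    rewrite exchange_tlift; apply: eq_tlift => d1 d2.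
    by rewrite exchange_tlift.
  rewrite exchange_tlift mulr_tlift; apply: eq_tlift => d1 d2.
  transitivity (c * a * d1 * tlift (fun x y => p (x * d2) * y) (Delta b)).
    rewrite mulr_tlift; apply: eq_tlift => b1 b2.
    rewrite sandwichE tlift_mulr mulr_tlift; apply: eq_tlift => g1 g2.
    rewrite tlift_mulr mulr_tlift; apply: eq_tlift => y z.
    by rewrite !mulrA.
  rewrite -Cp !mulr_tlift; apply: eq_tlift => b1 b2.
  by rewrite !mulrA.
transitivity (tlift (fun c d =>
    tlift (fun a b => L ((c * a) \ox (d * b))) F) G).
  apply: eq_tlift => c d; rewrite -e2 -eqF -e1; apply: eq_tlift => a b.
  congr (_ * _ * _); apply: (etrans (@convE k K _ _ _)).
  by apply: eq_tlift => x y; rewrite lfunE.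
transitivity (L (G * F)).
  rewrite /L tliftM; last by rewrite /M; tlift_bilin.
  apply: eq_tlift => c d; apply: eq_tlift => a b.
  by rewrite tlift_tens // /M; tlift_bilin.
rewrite mulVr // /L -tens_one tlift_tens; last by rewrite /M; tlift_bilin.
by rewrite mul1r mulr1; apply: eq_tlift => x y; rewrite !lfunE.
Qed.

(** The counit leaves eps(h) G' eps(G'') eps(F') F'', and the normalisations of F and F^-1 make the
    last factors 1. *)
Lemma sandwich_conv1 : sandwich F G (conv1 K) = conv1 H.
Proof.
have [unitF epslF epsrF _] := twF; apply/lfunP=> h; rewrite sandwichE conv1E.
have epsrG : eps_r G = 1 by rewrite rmorphV //= epsrF invr1.
transitivity ((counit h : k) *: (eps_r G * eps_l F)).
  rewrite /eps_r /eps_l tlift_mulr -tliftZ; apply: eq_tlift => c d.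
  rewrite mulr_tlift -tliftZ; apply: eq_tlift => a b.
  rewrite (@conv1E k K) /= !rmorphM /= -!(scalerAl, scalerAr) mulr1.
  by rewrite !scalerA; congr (_ *: _); rewrite [RHS]mulrC mulrA.
by rewrite epsrG epslF mulr1.
Qed.

(** Let q' be the preimage of S * p under Phi. By [sandwich_conv_id], Phi(id *_F q') = id * (S * p)
    = p = Phi(q), so id *_F q' = q, and convolving with S_F gives S_F *_F q = q'. *)
Lemma sandwich_conv_antipode q :
  comul_central (sandwich F G q) ->
  sandwich F G (@conv k K (linfun antipode) q) =
  @conv k H (linfun antipode) (sandwich F G q).
Proof.
have [unitF _ _ _] := twF; set p := sandwich F G q => Cp.
pose q' := sandwich G F (@conv k H (linfun antipode) p).
have q'E : sandwich F G q' = @conv k H (linfun antipode) p.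
  by rewrite sandwich_comp !mulVr // sandwich1.
have Iq' : @conv k K \1%VF q' = q.
  rewrite -[LHS]sandwich1 -(divrr unitF) -sandwich_comp sandwich_conv_id.
    by rewrite q'E conv_idK sandwich_comp divrr // sandwich1.
  by rewrite q'E; apply: comul_central_conv_antipode.
by rewrite -Iq' (@conv_antipodeK k K).
Qed.

Lemma sandwich_sweedler_power (m : int) :
  sandwich F G (@sweedler_power k K m) = @sweedler_power k H m.
Proof.
suff: sandwich F G (@sweedler_power k K m) = @sweedler_power k H m /\
    comul_central (@sweedler_power k H m) by case.
case: m => m /=.
  elim: m => [|m [IH Cm]] /=.
    by split; [apply: sandwich_conv1 | apply: comul_central_conv1].
  by split; [rewrite sandwich_conv_id IH | apply: comul_central_conv_id].
suff: sandwich F G (@conv_exp k K (linfun antipode) m.+1) =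
    @conv_exp k H (linfun antipode) m.+1 /\
    comul_central (@conv_exp k H (linfun antipode) m.+1) by [].
(* The exponent [m.+1] is generalised to any natural number, so that the induction starts at the
   convolution unit. *)
elim: m.+1 => {m} [|m [IH Cm]] /=.
  by split; [apply: sandwich_conv1 | apply: comul_central_conv1].
split; last exact: comul_central_conv_antipode.
by rewrite sandwich_conv_antipode IH.
Qed.

Lemma nu_twist n : nu K n = nu H n.
Proof.
by rewrite /nu -sandwich_sweedler_power; apply: trace_twist_antipode.
Qed.

End TwistIndicators.

(** * Invariance under isomorphism *)

Section HopfIso.
Context {k : fieldType} {H H' : hopfAlgType k}.
Variables (f : {lrmorphism H -> H'}) (isof : hopf_iso f).
Local Notation phi := (linfun f).

Lemma hopf_iso_conv (p q : 'End(H)) (p' q' : 'End(H')) :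
  (phi \o p = p' \o phi)%VF -> (phi \o q = q' \o phi)%VF ->
  (phi \o conv p q = conv p' q' \o phi)%VF.
Proof.
move=> /lfunP pE /lfunP qE; have [_ comulf _ _] := isof.
apply/lfunP=> h; rewrite !comp_lfunE !convE !lfunE /= comulf /tmap.
rewrite !linear_tlift; apply: eq_tlift => x y /=.
rewrite tlift_tens; last by tlift_bilin.
move: (pE x) (qE y); rewrite !comp_lfunE !lfunE /= rmorphM => px qy.
by congr (_ * _).
Qed.

Lemma hopf_iso_sweedler_power m :
  (phi \o sweedler_power H m = sweedler_power H' m \o phi)%VF.
Proof.
have [_ _ counitf antif] := isof.
have exp p p' e : (phi \o p = p' \o phi)%VF ->
    (phi \o conv_exp p e = conv_exp p' e \o phi)%VF.
  move=> pE; elim: e => [|e IH] /=; last exact: hopf_iso_conv.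
  apply/lfunP=> h; rewrite !comp_lfunE !conv1E !lfunE /= counitf.
  by rewrite linearZ /= rmorph1.
by case: m => m; apply: exp; apply/lfunP=> h; rewrite !comp_lfunE !lfunE /=.
Qed.

Lemma nu_hopf_iso n : nu H n = nu H' n.
Proof.
have [[g fK gK] _ _ antif] := isof.
have ker0 : lker phi == 0%VS.
  by apply/lker0P=> x y; rewrite !lfunE; apply: (can_inj fK).
have phiV : (phi \o phi^-1)%VF = \1%VF.
  apply/lfunP=> y; rewrite comp_lfunE id_lfunE -[y]gK.
  have <- : phi (g y) = f (g y) by rewrite lfunE.
  by rewrite (lker0_lfunK ker0).
pose A (K : hopfAlgType k) : 'End(K) :=
  (linfun antipode \o sweedler_power K (n - 1))%VF.
have AE : (phi \o A H = A H' \o phi)%VF.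
  rewrite /A -comp_lfunA -hopf_iso_sweedler_power !comp_lfunA.
  congr (_ \o _)%VF; apply/lfunP=> h.
  by rewrite !comp_lfunE !lfunE /= antif.
(* [A H] is the conjugate phi^-1 o [A H'] o phi, and cyclicity between the two spaces removes
   phi. *)
rewrite /nu -!/(A _) -[A H]comp_lfun1l -(lker0_compVf ker0) -comp_lfunA AE.
by rewrite lfun_trace_comp -comp_lfunA phiV comp_lfun1r.
Qed.

End HopfIso.

Theorem theorem3p10 (k : fieldType) (n : int) (H H' : hopfAlgType k) :
  gauge_equivalent H H' -> nu H n = nu H' n.
Proof.
by case=> F [twF [f isof]]; rewrite (nu_hopf_iso isof) nu_twist.
Qed.
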